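(* Let $G$ and $H$ be mixed graphs. Then $G$ and $H$ are TF-isomorphic if and only if $\mathbf{ADC}(G)$ and $\mathbf{ADC}(H)$ are isomorphic.
   Context: A mixed graph $G=(V(G),A(G))$ consists of a set $V(G)$ of vertices and a set $A(G)$ of ordered pairs of elements of $V(G)$, called arcs (loops are allowed; no multiple arcs). A TF-isomorphism from $G$ to $H$ is a pair $(\alpha,\beta)$ of bijections $V(G)\to V(H)$ such that $(u,v)\in A(G)$ if and only if $(\alpha(u),\beta(v))\in A(H)$; $G$ and $H$ are TF-isomorphic if such a pair exists. The $\mathbf{A}$-cover (alternating double cover) $\mathbf{ADC}(G)$ is the digraph with arc set $\{((u,0),(v,1)) : (u,v)\in A(G)\}$ whose vertices are exactly those elements of $V(G)\times\{0,1\}$ incident with at least one of these arcs (isolated vertices are discarded).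
   Formalization: The ''if'' half assumes also that G and H are finite with equally many vertices, or that equally many vertices are discarded at level 0 and at level 1; without this it fails (arcless graphs on 1 and 2 vertices), and TF-isomorphism implies it. *)

(* Defs.v *)
From HB Require Import structures.
From mathcomp Require Import all_boot all_classical.
Local Open Scope classical_set_scope.
Local Open Scope card_scope.

(* V(G) is the carrier type: it may be empty or infinite. An undirected edge
   is a pair of opposite arcs. Digraphs are objects of this same type. *)
Record mixed_graph := MixedGraph {
  vertex :> Type;
  arcs : set (vertex * vertex) }.

Definition isomorphism (G H : mixed_graph) (f : G -> H) : Prop :=
  bijective f /\ forall u v : G, arcs G (u, v) <-> arcs H (f u, f v).

Definition isomorphic (G H : mixed_graph) : Prop :=
  exists f : G -> H, isomorphism G H f.

Definition TF_isomorphism (G H : mixed_graph) (alpha beta : G -> H) : Prop :=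
  [/\ bijective alpha, bijective beta
    & forall u v : G, arcs G (u, v) <-> arcs H (alpha u, beta v)].

Definition TF_isomorphic (G H : mixed_graph) : Prop :=
  exists alpha beta : G -> H, TF_isomorphism G H alpha beta.

(* The set {0,1} is bool, with 0 = false and 1 = true. *)
Definition ADC_arcs (G : mixed_graph) : set ((G * bool) * (G * bool)) :=
  [set ((a.1, false), (a.2, true)) | a in arcs G].

Definition ADC_vertices (G : mixed_graph) : set (G * bool) :=
  [set x | exists y, ADC_arcs G (x, y) \/ ADC_arcs G (y, x)].

Definition ADC (G : mixed_graph) : mixed_graph :=
  MixedGraph (set_type (ADC_vertices G))
    [set a | ADC_arcs G (val a.1, val a.2)].

Definition discarded (G : mixed_graph) (i : bool) : set G :=
  [set u | ~ ADC_vertices G (u, i)].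

(* ADC(G) does not record how many vertices were discarded, so ADC(G) and
   ADC(H) may be isomorphic although V(G) and V(H) are not even equipotent
   (e.g. arcless graphs on 1 and on 2 vertices). This relation says that G and
   H agree on that missing number: for finite graphs it is enough that they
   have equally many vertices; for infinite ones the discarded vertices have
   to be compared at each of the two levels. *)
Definition same_vertex_count (G H : mixed_graph) : Prop :=
  (finite_set [set: G] /\ [set: G] #= [set: H]) \/
  (forall i : bool, discarded G i #= discarded H i).

(* Main.v *)
Require Import Defs.
From mathcomp Require Import all_boot all_classical finmap.

(** The A-cover has all its arcs going from level 0 to level 1, and an arc of
    [G] from [u] to [v] becomes the arc from [(u, 0)] to [(v, 1)]. A pair
    [(alpha, beta)] therefore acts on [G * bool], by [alpha] at level 0 and by
    [beta] at level 1, and it is a TF-isomorphism exactly when this action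
    respects the arcs of the covers. Such an action respects the property of
    being incident with an arc, hence restricts to the covers.

    Conversely, no vertex of a cover is isolated, so level 0 consists of the
    vertices with an out-arc; an isomorphism of covers thus preserves levels
    ([isomorphism_level]) and splits into one bijection per level, between the
    sets of vertices of [G] and of [H] that are retained at that level
    ([isomorphism_retained]). Each of the two extends to a bijection from [G]
    to [H] as soon as the discarded vertices can be matched too
    ([extend_bijection]). For finite graphs with equally many vertices this is
    a subtraction of cardinals ([card_eq_setC]). The discarded vertices carry no
    arc at the level concerned, so how they are matched does not matter. *)

Local Open Scope classical_set_scope.
Local Open Scope card_scope.

(** * Extending bijections between subsets *)

(** Cardinal subtraction is valid for finite sets only, whence the hypothesis
    on [T]; [U] is then finite as well. *)
Lemma card_eq_setC (T U : Type) (A : set T) (B : set U) :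
  finite_set [set: T] -> [set: T] #= [set: U] -> A #= B -> ~` A #= ~` B.
Proof.
(* Counting elements of a finite set requires choice types. *)
suff main (T' U' : choiceType) (A' : set T') (B' : set U') :
    finite_set [set: T'] -> [set: T'] #= [set: U'] -> A' #= B' ->
    ~` A' #= ~` B'.
  exact: (main {classic T} {classic U} A B).
move=> finT TU AB.
have finU : finite_set [set: U'] by rewrite -(eq_finite_set TU).
have finTS (S : set T') : finite_set S by exact: sub_finite_set finT.
have finUS (S : set U') : finite_set S by exact: sub_finite_set finU.
have cardC (V : choiceType) (C : set V) : (forall S : set V, finite_set S) ->
    #|` fset_set (~` C)| =
    (#|` fset_set [set: V]| - #|` fset_set C|)%N.
  move=> finV; rewrite -setTD fset_setD// cardfsDS//.
  by rewrite -fset_set_sub.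
have cardE (S : set T') (S' : set U') : S #= S' ->
    #|` fset_set S| = #|` fset_set S'|.
  by move/(fcard_eq (finTS S) (finUS S')).
by apply/fcard_eq => //; rewrite !cardC// (cardE _ _ TU) (cardE _ _ AB).
Qed.

(** The extension follows [f] on [A] and an arbitrary bijection on the
    complement; gluing the inverses in the same way inverts it. Working with
    functions between subset types avoids a default value in [U], which may be
    empty. *)
Lemma extend_bijection (T U : Type) (A : set T) (B : set U) (f : A -> B) :
  bijective f -> ~` A #= ~` B ->
  exists h : T -> U, [/\ bijective h,
    forall a : A, h (val a) = val (f a) & forall x, B (h x) -> A x].
Proof.
move=> [f' fK f'K] /card_bijP[g [g' gK g'K]].
pose glue V W (C : set V) (D : set W) (k : C -> D) (l : ~` C -> ~` D) x :=
  match pselect (C x) with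
  | left Cx => val (k (SigSub (mem_set Cx)))
  | right nCx => val (l (SigSub (mem_set (nCx : (~` C) x))))
  end.
have glueL V W (C : set V) (D : set W) k l (c : C) :
    glue V W C D k l (val c) = val (k c).
  rewrite /glue; case: pselect => [Cc|[]]; last exact: set_valP.
  by congr (val (k _)); apply: val_inj.
have glueR V W (C : set V) (D : set W) k l (c : ~` C) :
    glue V W C D k l (val c) = val (l c).
  rewrite /glue; case: pselect => [Cc|nCc].
    by have := set_valP c.
  by congr (val (l _)); apply: val_inj.
have glueK V W (C : set V) (D : set W) k l k' l' :
    cancel k k' -> cancel l l' ->
    cancel (glue V W C D k l) (glue W V D C k' l').
  move=> kK lK x; have [Cx|nCx] := pselect (C x).
    by rewrite -[x]/(val (SigSub (mem_set Cx) : C)) !glueL kK.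
  by rewrite -[x]/(val (SigSub (mem_set (nCx : (~` C) x)) : ~` C)) !glueR lK.
exists (glue _ _ _ _ f g); split.
- by exists (glue _ _ _ _ f' g'); apply: glueK.
- by move=> a; rewrite glueL.
- move=> x; rewrite /glue; case: pselect => // nAx.
  by have := set_valP (g (SigSub (mem_set (nAx : (~` A) x)))).
Qed.

(** * Arcs and levels of the cover *)

Lemma ADC_arcsP (G : mixed_graph) (x y : G * bool) :
  ADC_arcs G (x, y) <-> [/\ x.2 = false, y.2 = true & arcs G (x.1, y.1)].
Proof.
case: x y => [u i] [v j]; split=> [[[a b] ab [<- <- <- <-]]//|/= [-> -> uv]].
by exists (u, v).
Qed.

(** The level of a vertex of the cover is visible in the abstract digraph: a
    vertex without out-arc is not isolated, so it has an in-arc, which only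
    vertices at level 1 have. *)
Lemma ADC_level (G : mixed_graph) (x : ADC G) :
  (val x).2 = false <-> exists y : ADC G, arcs (ADC G) (x, y).
Proof.
split=> [x0|[y /ADC_arcsP[]//]].
have [y [xy|/ADC_arcsP[_]]] := set_valP x; last by rewrite x0.
have Vy : ADC_vertices G y by exists (val x); right.
by exists (SigSub (mem_set Vy)).
Qed.

Lemma isomorphism_level (G H : mixed_graph) (f : ADC G -> ADC H) :
  isomorphism (ADC G) (ADC H) f -> forall x, (val (f x)).2 = (val x).2.
Proof.
move=> [[g fK gK] fA] x.
have : (val (f x)).2 = false <-> (val x).2 = false.
  split=> /ADC_level[y xy]; apply/ADC_level.
    by exists (g y); apply/fA; rewrite gK.
  by exists (f y); apply/fA.
by case: (val (f x)).2 (val x).2 => [] [] [] // => [_ ->|->].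
Qed.

(** * From TF-isomorphisms to isomorphisms of covers *)

(** Isolated vertices of [G * bool] correspond under such a [phi], so
    discarding them on both sides is harmless. *)
Lemma isomorphic_ADC (G H : mixed_graph) (phi : G * bool -> H * bool) :
  bijective phi ->
  (forall x y, ADC_arcs G (x, y) <-> ADC_arcs H (phi x, phi y)) ->
  isomorphic (ADC G) (ADC H).
Proof.
move=> [psi phiK psiK] phiA.
have phiV x : ADC_vertices G x -> ADC_vertices H (phi x).
  by move=> [y [/phiA xy|/phiA yx]]; exists (phi y); [left|right].
have psiV x : ADC_vertices H x -> ADC_vertices G (psi x).
  move=> [y [xy|yx]]; exists (psi y); [left|right].
    by apply/phiA; rewrite !psiK.
  by apply/phiA; rewrite !psiK.
exists (fun x : ADC G => SigSub (mem_set (phiV _ (set_valP x))) : ADC H).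
split=> [|x y]; last exact: phiA.
exists (fun x : ADC H => SigSub (mem_set (psiV _ (set_valP x))) : ADC G).
  by move=> x; apply: val_inj; apply: phiK.
by move=> x; apply: val_inj; apply: psiK.
Qed.

Lemma TF_isomorphic_ADC (G H : mixed_graph) :
  TF_isomorphic G H -> isomorphic (ADC G) (ADC H).
Proof.
move=> [alpha [beta [[alpha' aK a'K] [beta' bK b'K] abA]]].
apply: (@isomorphic_ADC _ _
  (fun x => (if x.2 then beta x.1 else alpha x.1, x.2))).
  exists (fun x => (if x.2 then beta' x.1 else alpha' x.1, x.2)).
    by move=> [u []] /=; rewrite ?aK ?bK.
  by move=> [u []] /=; rewrite ?a'K ?b'K.
move=> [u i] [v j]; split=> /ADC_arcsP[/= i0 j1]; subst i j => /abA uv.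
  exact/ADC_arcsP.
exact/ADC_arcsP.
Qed.

(** * From isomorphisms of covers to TF-isomorphisms *)

Definition retained (G : mixed_graph) (i : bool) : set G :=
  [set u | ADC_vertices G (u, i)].

Definition retained_vertex (G : mixed_graph) (i : bool)
    (u : retained G i) : ADC G :=
  SigSub (mem_set (set_valP u : ADC_vertices G (val u, i))).

Lemma retained_vertex_inj (G : mixed_graph) (i : bool) :
  injective (retained_vertex G i).
Proof. by move=> u v /(congr1 val)[]; apply: val_inj. Qed.

Lemma arcs_retained (G : mixed_graph) (u v : G) :
  arcs G (u, v) -> retained G false u /\ retained G true v.
Proof.
move=> uv; have ADCuv : ADC_arcs G ((u, false), (v, true)) by exact/ADC_arcsP.
by split; [exists (v, true); left|exists (u, false); right].
Qed.

Lemma arcs_retained_vertex (G : mixed_graph)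
    (u : retained G false) (v : retained G true) :
  arcs (ADC G) (retained_vertex G false u, retained_vertex G true v) <->
  arcs G (val u, val v).
Proof.
by split=> [/ADC_arcsP[]|uv] //; apply/ADC_arcsP.
Qed.

Lemma level_map_retained (G H : mixed_graph) (f : ADC G -> ADC H) (i : bool) :
  (forall x, (val (f x)).2 = (val x).2) ->
  exists f_i : retained G i -> retained H i,
    forall u, retained_vertex H i (f_i u) = f (retained_vertex G i u).
Proof.
move=> flevel.
have fE (u : retained G i) : val (f (retained_vertex G i u)) =
    ((val (f (retained_vertex G i u))).1, i).
  by rewrite [LHS]surjective_pairing flevel.
have fR (u : retained G i) :
    retained H i (val (f (retained_vertex G i u))).1.
  by rewrite /retained/= -fE; exact: set_valP.
exists (fun u => SigSub (mem_set (fR u))) => u.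
exact/val_inj/esym/fE.
Qed.

Lemma isomorphism_retained (G H : mixed_graph) (f : ADC G -> ADC H)
    (i : bool) : isomorphism (ADC G) (ADC H) f ->
  exists2 f_i : retained G i -> retained H i, bijective f_i &
    forall u, retained_vertex H i (f_i u) = f (retained_vertex G i u).
Proof.
move=> fiso; have flevel := isomorphism_level _ _ _ fiso.
have [[g fK gK] _] := fiso.
have glevel x : (val (g x)).2 = (val x).2 by rewrite -flevel gK.
have [f_i f_iE] := level_map_retained _ _ _ i flevel.
have [g_i g_iE] := level_map_retained _ _ _ i glevel.
exists f_i => //; exists g_i => u; apply: retained_vertex_inj.
  by rewrite g_iE f_iE fK.
by rewrite f_iE g_iE gK.
Qed.

(** For infinite graphs the conclusion is what [same_vertex_count] asserts; for
    finite ones it follows because the retained vertices are equinumerous. *)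
Lemma discarded_card_eq (G H : mixed_graph) (i : bool) :
  same_vertex_count G H -> isomorphic (ADC G) (ADC H) ->
  ~` retained G i #= ~` retained H i.
Proof.
move=> [[finG GH] [f fiso]|discGH _]; last exact: discGH.
apply: card_eq_setC => //; apply/card_bijP.
by have [f_i] := isomorphism_retained _ _ _ i fiso; exists f_i.
Qed.

Lemma ADC_isomorphic_TF (G H : mixed_graph) :
  same_vertex_count G H -> isomorphic (ADC G) (ADC H) -> TF_isomorphic G H.
Proof.
move=> countGH isoGH; have [f fiso] := isoGH.
have discGH i := discarded_card_eq _ _ i countGH isoGH.
have [f0 f0bij f0E] := isomorphism_retained _ _ _ false fiso.
have [f1 f1bij f1E] := isomorphism_retained _ _ _ true fiso.
have [alpha [abij alphaE alphaR]] :=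
  extend_bijection _ _ _ _ _ f0bij (discGH false).
have [beta [bbij betaE betaR]] :=
  extend_bijection _ _ _ _ _ f1bij (discGH true).
exists alpha, beta; split=> // u v.
have arcsE (u0 : retained G false) (v1 : retained G true) :
    arcs G (val u0, val v1) <-> arcs H (alpha (val u0), beta (val v1)).
  rewrite alphaE betaE; split.
    move=> /arcs_retained_vertex/fiso.2.
    by rewrite -f0E -f1E => /arcs_retained_vertex.
  move=> /arcs_retained_vertex; rewrite f0E f1E.
  by move=> /fiso.2/arcs_retained_vertex.
have arcsR (Ru : retained G false u) (Rv : retained G true v) :=
  arcsE (SigSub (mem_set Ru)) (SigSub (mem_set Rv)).
split=> uv.
  by have [Ru Rv] := arcs_retained _ _ _ uv; apply/arcsR.
(* Only retained vertices are mapped to endpoints of arcs of [H]. *)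
by have [/alphaR Ru /betaR Rv] := arcs_retained _ _ _ uv; apply/arcsR.
Qed.

Theorem theorem6p1 (G H : mixed_graph) :
  (TF_isomorphic G H -> isomorphic (ADC G) (ADC H)) /\
  (same_vertex_count G H ->
     isomorphic (ADC G) (ADC H) -> TF_isomorphic G H).
Proof.
split; [exact: TF_isomorphic_ADC|exact: ADC_isomorphic_TF].
Qed.
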